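(* Let $d=1$, $\Omega=(0,L)$ with $L>0$, and $U\equiv0$, so that the Hessian lower bound of $U$ holds with $K=0$ and the Poincaré constant (Neumann spectral gap of $\Omega$) is $m=\pi^2/L^2$. Assume the well-posedness assumption (WP) stated in the context. For $\gamma>0$ define the optimal $L^2$ decay rate of the specularly reflected semigroup with friction $\gamma$, $$\Lambda_{\mathrm{opt}}(\gamma):=\sup\Big\{\Lambda\ge0:\ \exists\,C<\infty\text{ with }\big\|e^{t\mathscr L}\big\|_{L^2_0(\mu)\to L^2_0(\mu)}\le Ce^{-\Lambda t}\text{ for all }t\ge0\Big\}.$$ Then $$\Lambda_{\mathrm{opt}}(\gamma)\le\min\Big\{\frac m\gamma,\,2\gamma\Big\}\qquad\text{for every }\gamma>0,$$ and consequently $$\sup_{\gamma>0}\Lambda_{\mathrm{opt}}(\gamma)\le\sqrt{2m},$$ where the supremum over $\gamma>0$ of $\min\{m/\gamma,2\gamma\}$ is attained at $\gamma=\sqrt{m/2}$ (with value $\sqrt{2m}$). In particular, no choice of the friction coefficient produces a decay rate better than $O(\sqrt m)$.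
   Context: $\mu$ is the probability measure $\mu=\mu_x\otimes\kappa$ on $(0,L)\times\mathbb{R}$, where $\mu_x$ is the normalized Lebesgue measure on $(0,L)$ and $\kappa$ is the standard Gaussian measure on $\mathbb{R}$. $L^2(\mu)$ is real and $L^2_0(\mu)=\{f\in L^2(\mu):\int f\,d\mu=0\}$. For $\gamma>0$ the operator $\mathscr L=\mathscr L_\gamma$ is $$\mathscr L f=v\,\partial_xf+\gamma(-v\,\partial_vf+\partial_v^2f),$$ considered with the specular boundary condition $f(x,v)=f(x,-v)$ for $x\in\{0,L\}$, $v\in\mathbb{R}$. Specular class: $\mathscr C$ is the set of $f\in C^2([0,L]\times\mathbb{R})$ such that, for some $N\in(0,\infty)$ and constants $C_\alpha<\infty$ depending on $f$, $|\partial^\alpha f(x,v)|\le C_\alpha(1+|v|)^N$ for all $(x,v)\in[0,L]\times\mathbb{R}$ and all multi-indices $|\alpha|\le2$ (mixed derivatives in $(x,v)$), and $f(x,v)=f(x,-v)$ for $x\in\{0,L\}$, $v\in\mathbb{R}$. $\mathscr C_0:=\mathscr C\cap L^2_0(\mu)$. Assumption (WP) (for each $\gamma>0$): the operator $\mathscr L$ with the specular boundary condition generates a strongly continuous contraction semigroup $(e^{t\mathscr L})_{t\ge0}$ on $L^2(\mu)$ preserving $L^2_0(\mu)$; the class $\mathscr C_0$ is a core for the generator of the semigroup restricted to $L^2_0(\mu)$ (whose domain is denoted $D(\mathscr L)$); this generator coincides on $\mathscr C_0$ with the differential operator above; and for $f_0\in D(\mathscr L)$ the trajectory $f(t)=e^{t\mathscr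 L}f_0$ satisfies $f\in C([0,\infty);D(\mathscr L))\cap C^1([0,\infty);L^2_0(\mu))$. *)

(* Defs.v *)
From HB Require Import structures.
From mathcomp Require Import all_boot all_order all_algebra.
From mathcomp Require Import all_classical all_reals all_analysis.
Set Implicit Arguments.
Unset Strict Implicit.
Unset Printing Implicit Defensive.
Import Order.TTheory GRing.Theory Num.Theory.
Import numFieldNormedType.Exports.
Local Open Scope classical_set_scope.
Local Open Scope ring_scope.

Section Poincare.
Context {R : realType} (L : R) (L0 : 0 < L).

(* [phi] is C^1 on the closed interval [0, L]: differentiable inside, with
   [dphi] the continuous extension of the derivative up to the endpoints.
   Values outside [0, L] are irrelevant. *)
Definition C1_interval (phi dphi : R -> R) : Prop :=
  [/\ {within `[0, L], continuous phi},
      {within `[0, L], continuous dphi} &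
      forall x : R, 0 < x < L -> is_derive x 1 phi (dphi x)].

Definition interval_mean (phi : R -> R) : R :=
  (\int[uniform_prob L0]_(x in `[0%R, L]) phi x)%R.

Definition interval_variance (phi : R -> R) : R :=
  interval_mean (fun x => (phi x - interval_mean phi) ^+ 2).

(* The best constant in c * Var(phi) <= \int |phi'|^2; no boundary condition is
   imposed on [phi], so this is the Neumann spectral gap of (0, L). *)
Definition poincare_constant : \bar R :=
  ereal_sup [set c%:E | c in [set c : R | forall phi dphi : R -> R,
    C1_interval phi dphi ->
    c * interval_variance phi <= interval_mean (fun x => dphi x ^+ 2)]].

End Poincare.

Section SpecularClass.
Context {R : realType} (L : R).

Definition closed_strip : set (R * R) := [set p | 0 <= p.1 <= L].
Definition open_strip : set (R * R) := [set p | 0 < p.1 < L].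

(* [f] is C^2 on [0, L] x R: [D i j] is the partial derivative
   d^(i+j) f / dx^i dv^j in the open strip, extended continuously to the closed
   strip. Both orders of the mixed derivative are required to be [D 1 1]. Values
   of [f] outside the closed strip are irrelevant. *)
Definition C2_strip (f : R * R -> R) (D : nat -> nat -> R * R -> R) : Prop :=
  [/\ forall p, closed_strip p -> D 0%N 0%N p = f p,
      forall i j, (i + j <= 2)%N ->
        {within closed_strip, continuous (D i j)} &
      forall i j, (i + j < 2)%N -> forall p, open_strip p ->
        is_derive p (1, 0) (D i j) (D i.+1 j p) /\
        is_derive p (0, 1) (D i j) (D i j.+1 p)].

Definition specular_bc (f : R * R -> R) : Prop :=
  forall v, f (0, v) = f (0, - v) /\ f (L, v) = f (L, - v).

Definition specular_class (f : R * R -> R) : Prop :=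
  specular_bc f /\
  exists2 D, C2_strip f D &
  exists2 N, 0 < N & forall i j, (i + j <= 2)%N ->
    exists C, forall p, closed_strip p ->
      `|D i j p| <= C * (1 + `|p.2|) `^ N.

Definition kfp_operator (gamma : R) (f : R * R -> R) (p : R * R) : R :=
  p.2 * 'D_(1, 0) f p +
  gamma * (- p.2 * 'D_(0, 1) f p + 'D_(0, 1) ('D_(0, 1) f) p).

End SpecularClass.

Section L2.
Context {R : realType} (L : R) (L0 : 0 < L).

(* The measure charges only (0, L) x R, so that its L^2 space over R x R is the
   L^2 space over (0, L) x R. *)
Definition phase_measure :
    {measure set (measurableTypeR R * measurableTypeR R) -> \bar R} :=
  (uniform_prob L0 \x normal_prob 0 1)%E.

(* Square-integrable functions, not yet identified when they agree a.e.; every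
   identity below that concerns elements of L^2 is therefore stated a.e., and
   limits are taken in the seminorm [l2norm]. *)
Definition L2fun := LfunType phase_measure (lee1n 2).

Definition l2norm (u : L2fun) : R := fine ('N[phase_measure]_2[EFin \o u])%E.

Definition L20 : set L2fun :=
  [set u | (\int[phase_measure]_p u p)%R = 0].

Definition specular_class0 : set L2fun :=
  [set u | L20 u /\
    exists2 f, specular_class L f & u = f %[ae phase_measure]].

(* The graph of the generator of the semigroup [S] restricted to L^2_0. *)
Definition generator0 (S : R -> L2fun -> L2fun) (u w : L2fun) : Prop :=
  [/\ L20 u, L20 w &
      l2norm (h^-1 *: (S h u - u) - w) @[h --> 0^'+] --> (0 : R)].

Definition l2_continuous (F : R -> L2fun) : Prop :=
  forall t, 0 <= t ->
    l2norm (F s - F t) @[s --> within [set s | 0 <= s] (nbhs t)] --> (0 : R).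

Definition l2_derivative (F dF : R -> L2fun) : Prop :=
  forall t, 0 <= t ->
    l2norm ((s - t)^-1 *: (F s - F t) - dF t)
      @[s --> within [set s | 0 <= s] t^'] --> (0 : R).

(* [S] only matters at nonnegative times. Linearity and contractivity imply that
   [S t] is compatible with a.e. equality. *)
Record well_posed (gamma : R) (S : R -> L2fun -> L2fun) : Prop := WellPosed {
  wp_linear : forall t, 0 <= t -> forall (a : R) (u w : L2fun),
    S t (a *: u + w) = a *: S t u + S t w %[ae phase_measure];
  wp_zero : forall u, S 0 u = u %[ae phase_measure];
  wp_add : forall s t, 0 <= s -> 0 <= t -> forall u,
    S (s + t) u = S s (S t u) %[ae phase_measure];
  wp_contraction : forall t, 0 <= t -> forall u, l2norm (S t u) <= l2norm u;
  wp_strongly_continuous : forall u,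
    l2norm (S t u - u) @[t --> 0^'+] --> (0 : R);
  wp_mean_zero : forall t, 0 <= t -> forall u, L20 u -> L20 (S t u);
  wp_class_domain : forall u, specular_class0 u -> exists w, generator0 S u w;
  wp_core : forall u w, generator0 S u w -> forall e, 0 < e ->
    exists u' w', [/\ specular_class0 u', generator0 S u' w',
                      l2norm (u - u') < e & l2norm (w - w') < e];
  wp_generator : forall u w f, specular_class0 u -> generator0 S u w ->
    specular_class L f -> u = f %[ae phase_measure] ->
    w = kfp_operator gamma f %[ae phase_measure];
  (* continuity into the domain is with respect to the graph norm *)
  wp_trajectory_domain : forall u w, generator0 S u w ->
    exists W : R -> L2fun,
      [/\ forall t, 0 <= t -> generator0 S (S t u) (W t),
          l2_continuous (S ^~ u) & l2_continuous W];
  wp_trajectory_C1 : forall u w, generator0 S u w ->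
    exists V : R -> L2fun,
      [/\ forall t, 0 <= t -> L20 (V t),
          l2_derivative (S ^~ u) V & l2_continuous V]
}.

Definition opnorm0 (T : L2fun -> L2fun) : \bar R :=
  ereal_sup [set (l2norm (T u))%:E | u in [set u | L20 u /\ l2norm u <= 1]].

(* The supremum is taken in the extended reals. *)
Definition optimal_decay_rate (S : R -> L2fun -> L2fun) : \bar R :=
  ereal_sup [set Lambda%:E | Lambda in [set Lambda : R | 0 <= Lambda /\
    exists C : R, forall t, 0 <= t ->
      (opnorm0 (S t) <= (C * expR (- Lambda * t))%:E)%E]].

End L2.

(* Main.v *)
(* Two explicit eigenfunctions of the operator satisfy the specular
   boundary condition. With k = pi / L, the wave cos (k (x + v / gamma)) has
   eigenvalue - k ^ 2 / gamma = - m / gamma, and the Hermite function v ^ 2 - 1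
   has eigenvalue - 2 gamma; on an eigenfunction with eigenvalue - r the
   semigroup acts as multiplication by exp (- r t), so no rate better than r is
   possible.
   For the Poincare constant, let phi have mean zero and primitive F, with
   F 0 = F L = 0. When k < pi / L, the integrand phi' ^ 2 - k ^ 2 phi ^ 2 is, up
   to an exact derivative, the sum of squares
   (phi' + k ^ 2 F) ^ 2 + k ^ 2 (phi + k F tan (k (x - L / 2))) ^ 2; the function
   cos (pi x / L) gives the converse bound. *)
Require Import Defs.
From HB Require Import structures.
From mathcomp Require Import all_boot all_order all_algebra.
From mathcomp Require Import all_classical all_reals all_analysis.
From mathcomp Require Import measurable_realfun.
From mathcomp Require Import ring lra.
Import Order.TTheory GRing.Theory Num.Theory.
Import numFieldNormedType.Exports.
Local Open Scope classical_set_scope.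
Local Open Scope ring_scope.

(** * The [L^2] seminorm and the total mass of the phase measure *)

Section L2norm.
Context {R : realType} (L : R) (L0 : 0 < L).
Notation mu := (phase_measure L0).
Implicit Types u w : L2fun L0.

Lemma l2norm_ge0 u : 0 <= l2norm u.
Proof. by rewrite fine_ge0// Lnorm_ge0. Qed.

Lemma l2normD u w : l2norm (u + w) <= l2norm u + l2norm w.
Proof. exact: ler_LnormD. Qed.

Lemma l2norm_leD u w a b :
  l2norm u <= a -> l2norm w <= b -> l2norm (u + w) <= a + b.
Proof. by move=> ua wb; rewrite (le_trans (l2normD u w))// lerD. Qed.

Lemma l2normZ (a : R) u : l2norm (a *: u) = `|a| * l2norm u.
Proof.
apply: EFin_inj; rewrite EFinM /l2norm.
have := finite_norm_fine (a *: u); have := finite_norm_fine u => /= -> ->.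
exact: LnormZ.
Qed.

Lemma l2norm0 : l2norm (0 : L2fun L0) = 0.
Proof. by rewrite -(scale0r (0 : L2fun L0)) l2normZ normr0 mul0r. Qed.

Lemma L2funDE u w p : (u + w) p = u p + w p. Proof. by []. Qed.

Lemma L2funNE u p : (- u) p = - u p. Proof. by []. Qed.

Lemma L2funZE a u p : (a *: u) p = a * u p. Proof. by []. Qed.

Lemma L2fun0E p : (0 : L2fun L0) p = 0. Proof. by []. Qed.

Definition L2funE := (L2funDE, L2funNE, L2funZE, L2fun0E).

(** Semigroup laws are available only almost everywhere; this turns them into rewriting rules under
    the seminorm. *)
Lemma l2norm_ae u w : u = w %[ae mu] -> l2norm u = l2norm w.
Proof.
move=> uw; rewrite /l2norm unlock /Lnorm.
suff -> : (\int[mu]_x (`|(EFin \o u) x| `^ 2) =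
           \int[mu]_x (`|(EFin \o w) x| `^ 2))%E by [].
apply: ae_eq_integral => //=.
- apply/measurable_EFinP.
  apply/(@measurableT_comp _ _ _ _ _ _ (fun x : R => x `^ 2)%R) => //.
  exact: measurableT_comp.
- apply/measurable_EFinP.
  apply/(@measurableT_comp _ _ _ _ _ _ (fun x : R => x `^ 2)%R) => //.
  exact: measurableT_comp.
by apply: filterS uw => x /= -> .
Qed.

Lemma l2norm_eq0 u : l2norm u = 0 -> u = 0 %[ae mu].
Proof. exact: fine_Lnormr_eq0. Qed.

Lemma l2norm_le0_ae u w : l2norm (u - w) <= 0 -> u = w %[ae mu].
Proof.
move=> h; have /l2norm_eq0 : l2norm (u - w) = 0.
  by apply/eqP; rewrite eq_le h l2norm_ge0.
by apply: filterS => x /(_ I) /= /eqP; rewrite subr_eq0 => /eqP.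
Qed.

Lemma phase_measureX (A B : set (measurableTypeR R)) :
  measurable A -> measurable B ->
  mu (A `*` B) = (uniform_prob L0 A * normal_prob 0 1 B)%E.
Proof. by move=> mA mB; apply: product_measure1E. Qed.

Lemma phase_measure_setT : mu setT = 1%E.
Proof.
by rewrite -setXTT phase_measureX// !probability_setT mule1.
Qed.

Lemma L2fun_integrable u : mu.-integrable setT (EFin \o u).
Proof.
apply/Lfun1_integrable/Lfun_subset12; last exact: LfunP.
by rewrite phase_measure_setT.
Qed.

Lemma L20Z a u : L20 u -> L20 (a *: u).
Proof.
rewrite /L20/= => u0; transitivity (a * \int[mu]_p u p); last by rewrite u0 mulr0.
by rewrite -RintegralZl//; exact: L2fun_integrable.
Qed.

End L2norm.

(** * Action of the semigroup on an eigenvector of its generator *)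

Lemma expRN_taylor1 (R : realType) (y : R) : 0 <= y ->
  `|expR (- y) - 1 + y| <= y ^+ 2.
Proof.
move=> y0; have h1 := expR_ge1Dx (- y).
have h2 : expR (- y) <= (1 + y)^-1.
  rewrite expRN lef_pV2 ?posrE ?expR_gt0 ?expR_ge1Dx//; lra.
have h3 : (1 + y)^-1 <= 1 - y + y ^+ 2.
  rewrite -div1r ler_pdivrMr; last lra.
  have : 0 <= y * y * y by rewrite !mulr_ge0.
  nra.
rewrite ger0_norm; lra.
Qed.

Section Semigroup.
Context {R : realType} (L : R) (L0 : 0 < L).
Notation mu := (phase_measure L0).
Implicit Types u w : L2fun L0.
Context (gamma : R) (S : R -> L2fun L0 -> L2fun L0).
Context (WP : well_posed gamma S).

Lemma semigroup_lin t a u w : 0 <= t ->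
  l2norm (S t (a *: u + w)) = l2norm (a *: S t u + S t w).
Proof. by move=> t0; apply: l2norm_ae; exact: (wp_linear WP). Qed.

(** The trajectory is compared with the exponential over [n] equal time steps: each step adds an
    error [o(t / n)], contractivity prevents earlier errors from growing, and so the total tends to
    0. *)
Lemma semigroup_eigenvector (r : R) u w : 0 < r -> generator0 S u w ->
  w = - r *: u %[ae mu] ->
  forall t, 0 <= t -> S t u = expR (- r * t) *: u %[ae mu].
Proof.
move=> r0 [_ _ uw] wru.
pose e t := expR (- r * t); pose a t := l2norm (S t u - e t *: u).
(* [a] is subadditive and o(h) at 0, hence vanishes. *)
have aD s t : 0 <= s -> 0 <= t -> a (s + t) <= a s + a t.
  move=> s0 t0; rewrite /a.
  (* The error at [s + t] is the error at [t] transported by the contraction [S s], plus the error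
     at [s] damped by the factor [e t <= 1]. *)
  rewrite (@l2norm_ae _ _ _ _ (S s (- e t *: u + S t u) +
      e t *: (S s u - e s *: u))); last first.
    have h1 := wp_add WP s0 t0 u.
    have h2 := wp_linear WP s0 (- e t) u (S t u).
    move: h1 h2; apply: filterS2 => x /(_ I) h1 /(_ I) h2 _.
    rewrite !L2funE h1 h2 !L2funE.
    have -> : e (s + t) = e s * e t by rewrite /e mulrDr expRD.
    rewrite /GRing.scale/=; ring.
  rewrite [leRHS]addrC; apply: l2norm_leD; last first.
    rewrite l2normZ ger0_norm ?expR_ge0// ler_piMl ?l2norm_ge0//.
    by rewrite -expR0 ler_expR mulNr oppr_le0 mulr_ge0// ltW.
  apply: (le_trans (wp_contraction WP s0 _)).
  by rewrite scaleNr addrC.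
have a_small : forall eps, 0 < eps -> \forall h \near 0^'+, a h <= eps * h.
  move=> eps eps0; pose n := l2norm u.
  have n0 : 0 <= n by exact: l2norm_ge0.
  (* The added 1 keeps the divisor in the bound on [h] positive even when [n = 0]. *)
  have c0 : 0 < r ^+ 2 * n + 1 by rewrite ltr_wpDl// mulr_ge0 ?sqr_ge0.
  near=> h.
  have h0 : 0 < h by [].
  have h1 : l2norm (h^-1 *: (S h u - u) - w) <= eps / 2.
    rewrite -[leLHS]ger0_norm ?l2norm_ge0// -normrN -sub0r.
    near: h; move/cvgrPdist_le : uw; apply; rewrite divr_gt0//.
  have h2 : h * (r ^+ 2 * n) <= eps / 2.
    have : h <= eps / 2 / (r ^+ 2 * n + 1).
      by near: h; apply: nbhs_right_le; rewrite !divr_gt0.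
    rewrite ler_pdivlMr// => /(le_trans _); apply.
    by apply: (ler_wpM2l (ltW h0)); rewrite lerDl.
  (* Since [w = - r u], the error splits into [h] times the defect of the difference quotient and
     the second-order Taylor remainder of [e] at 0. *)
  rewrite /a (@l2norm_ae _ _ _ _ (h *: (h^-1 *: (S h u - u) - w) +
     (- (e h - 1 + r * h)) *: u)); last first.
    apply: filterS wru => x /(_ I) wru _; rewrite !L2funE wru !L2funE.
    rewrite /GRing.scale/=; field; exact: lt0r_neq0.
  have := expRN_taylor1 _ _ (mulr_ge0 (ltW r0) (ltW h0)).
  rewrite -mulNr -/(e h) => h3.
  have h4 := ler_wpM2l (ltW h0) h1.
  have h5 := ler_wpM2r n0 h3.
  have h6 := ler_wpM2l (ltW h0) h2.
  have h7 : l2norm (h *: (h^-1 *: (S h u - u) - w)) <= h * (eps / 2).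
    by rewrite l2normZ (gtr0_norm h0).
  have h8 : l2norm (- (e h - 1 + r * h) *: u) <= (r * h) ^+ 2 * n.
    by rewrite l2normZ normrN.
  apply: (@le_trans _ _ (h * (eps / 2) + (r * h) ^+ 2 * n)).
    by apply: l2norm_leD.
  rewrite exprMn; lra.
have aM n t : 0 <= t -> a (n%:R * t) <= n%:R * a t.
  move=> t0; elim: n => [|n IH].
    rewrite !mul0r /a /e mulr0 expR0 scale1r.
    rewrite (@l2norm_ae _ _ _ _ (0 : L2fun L0)); last first.
      by apply: filterS (wp_zero WP u) => x /(_ I) h _; rewrite !L2funE h subrr.
    by rewrite l2norm0.
  rewrite -[n.+1]addn1 natrD !mulrDl !mul1r.
  by rewrite (le_trans (aD _ _ _ _))// ?mulr_ge0// lerD.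
move=> t t0; apply: l2norm_le0_ae; rewrite -/(a t).
have [->|tpos] := eqVneq t 0; first by have := aM 0%N 0 (lexx _); rewrite !mul0r.
have {tpos} {}t0 : 0 < t by rewrite lt_neqAle eq_sym tpos.
apply/ler_addgt0Pl => eps eps0; rewrite addr0.
(* With slope [eps / t], the [n] steps of length [t / n] accumulate exactly [eps]. *)
have eps't : 0 < eps / t by rewrite divr_gt0.
have [d /= d0 dP] := a_small _ eps't.
pose n := (Num.truncn (t / d)).+1.
have n0 : (0 : R) < n%:R by rewrite ltr0n.
have tn0 : 0 < t / n%:R by rewrite divr_gt0.
have tnd : t / n%:R < d.
  rewrite ltr_pdivrMr// mulrC -ltr_pdivrMr//.
  by rewrite /n truncnS_gt.
have := aM n (t / n%:R) (ltW tn0); rewrite mulrC divfK ?gt_eqF// => /le_trans; apply.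
have : a (t / n%:R) <= eps / t * (t / n%:R).
  by apply: dP => //=; rewrite sub0r normrN gtr0_norm.
move=> /(ler_wpM2l (ltW n0)) /le_trans; apply.
rewrite le_eqVlt; apply/orP; left; apply/eqP.
by field; rewrite !gt_eqF.
Unshelve. all: by end_near.
Qed.

(** Testing the operator norm on the normalized eigenvector gives [exp (- r t) <= C exp (- Lam t)]
    for all [t >= 0], which fails for large [t] once [Lam > r]. *)
Lemma optimal_rate_le_of_eigenvector (r : R) u w : 0 < r -> generator0 S u w ->
  w = - r *: u %[ae mu] -> 0 < l2norm u ->
  (optimal_decay_rate S <= r%:E)%E.
Proof.
move=> r0 Suw wru u0; apply: ge_ereal_sup => _ [Lam [Lam0 [C SC]] <-].
rewrite lee_fin leNgt; apply/negP => rLam.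
have H t : 0 <= t -> expR ((Lam - r) * t) <= C.
  move=> t0.
  have : (expR (- r * t) <= C * expR (- Lam * t)).
    rewrite -lee_fin (le_trans _ (SC t t0))//; apply: ereal_sup_ubound.
    exists ((l2norm u)^-1 *: u).
      split; first by apply: L20Z; case: Suw.
      by rewrite l2normZ ger0_norm ?invr_ge0 ?l2norm_ge0// mulVf// gt_eqF.
    congr EFin; transitivity (l2norm ((l2norm u)^-1 *: (expR (- r * t) *: u))).
      (* Linearity is stated for [a *: u + w], so a zero vector is inserted; contractivity makes its
         image vanish a.e. *)
      rewrite -[X in S t X]addr0 semigroup_lin//.
      apply: l2norm_ae.
      have h1 := semigroup_eigenvector _ _ _ r0 Suw wru _ t0.
      have h2 : S t (0 : L2fun L0) = (0 : L2fun L0) %[ae mu].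
        apply: l2norm_le0_ae; rewrite subr0 (le_trans (wp_contraction WP t0 _))//.
        by rewrite l2norm0.
      by move: h1 h2; apply: filterS2 => x /(_ I) h1 /(_ I) h2 _;
        rewrite !L2funE h1 h2 L2fun0E addr0.
    rewrite !l2normZ !ger0_norm ?invr_ge0 ?l2norm_ge0 ?expR_ge0//.
    by rewrite mulrCA mulVf ?mulr1// gt_eqF.
  rewrite -ler_pdivrMr ?expR_gt0// -expRN -expRD; congr (expR _ <= _); ring.
(* Time 0 gives [1 <= C], so [C / (Lam - r)] is an admissible time; there the bound reads
   [exp C <= C], against [1 + C <= exp C]. *)
have C1 := H _ (lexx 0); rewrite mulr0 expR0 in C1.
have := H (C / (Lam - r)); rewrite divr_ge0 ?subr_ge0 ?(ltW rLam)//; last lra.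
move=> /(_ isT); rewrite mulrC divfK ?subr_eq0 ?gt_eqF//.
have := expR_ge1Dx C; lra.
Qed.

End Semigroup.

(** * Wirtinger's inequality for functions of mean zero on an interval *)

Section Wirtinger.
Context {R : realType}.
Notation mu := (@lebesgue_measure R).
Local Notation "'int_' ( L ) f" := (\int[mu]_(x in `[0%R, L]) (f x))%R
  (at level 36, L at level 0, f at level 36).

Lemma within_continuousD (A : set R) (f g : R -> R) :
  {within A, continuous f} -> {within A, continuous g} ->
  {within A, continuous (fun x => f x + g x)}.
Proof. by move=> cf cg x; apply: cvgD; [exact: cf|exact: cg]. Qed.

Lemma within_continuousB (A : set R) (f g : R -> R) :
  {within A, continuous f} -> {within A, continuous g} ->
  {within A, continuous (fun x => f x - g x)}.
Proof. by move=> cf cg x; apply: cvgB; [exact: cf|exact: cg]. Qed.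

Lemma within_continuousM (A : set R) (f g : R -> R) :
  {within A, continuous f} -> {within A, continuous g} ->
  {within A, continuous (fun x => f x * g x)}.
Proof. by move=> cf cg x; apply: cvgM; [exact: cf|exact: cg]. Qed.

Lemma within_continuous_cst (A : set R) (a : R) :
  {within A, continuous (fun=> a)}.
Proof. by move=> x; exact: cst_continuous. Qed.

Lemma continuous_integrable_itv0 (L : R) (f : R -> R) :
  {within `[0, L], continuous f} -> mu.-integrable `[0, L] (EFin \o f).
Proof.
by move=> cf; apply: continuous_compact_integrable => //; exact: segment_compact.
Qed.

Lemma is_derive_primitive (L : R) (f : R -> R) (x : R) :
  {within `[0, L], continuous f} -> 0 < x < L ->
  is_derive x 1 (fun y => int_ (y) f) (f x).
Proof.
move=> cf /andP[x0 xL].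
have cfx : {for x, continuous f}.
  move: cf => /(continuous_within_itvP _ (lt_trans x0 xL))[+ _ _]; apply.
  by rewrite in_itv/= x0 xL.
have [d1 d2] := continuous_FTC1_closed xL (continuous_integrable_itv0 _ _ cf) x0 cfx.
by apply: DeriveDef; [exact: d1|rewrite -derive1E; exact: d2].
Qed.

Lemma within_continuous_primitive (L : R) (f : R -> R) : 0 <= L ->
  {within `[0, L], continuous f} ->
  {within `[0, L], continuous (fun y => int_ (y) f)}.
Proof.
move=> L0 cf; apply: parameterized_integral_continuous => //.
exact: continuous_integrable_itv0.
Qed.

(** The mean value theorem is applied to [H], which vanishes at 0, equals the integral of
    [dphi ^ 2 - k ^ 2 phi ^ 2] at [L], and has a sum of squares as derivative. *)
Lemma wirtinger_lt (L k : R) (phi dphi : R -> R) : 0 < L -> 0 < k ->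
  k * L < pi -> C1_interval L phi dphi -> int_ (L) phi = 0 ->
  k ^+ 2 * int_ (L) (fun x => phi x ^+ 2) <= int_ (L) (fun x => dphi x ^+ 2).
Proof.
move=> L0 k0 kLpi [cphi cdphi dphiE] mean0.
pose F y := int_ (y) phi.
pose q x := dphi x ^+ 2 - k ^+ 2 * phi x ^+ 2.
have cphi2 : {within `[0, L], continuous (fun x => phi x ^+ 2)} by exact: within_continuousM.
have cdphi2 : {within `[0, L], continuous (fun x => dphi x ^+ 2)} by exact: within_continuousM.
have ck2 : {within `[0, L], continuous (fun x => k ^+ 2 * phi x ^+ 2)}.
  by apply: within_continuousM => //; exact: within_continuous_cst.
have cq : {within `[0, L], continuous q} by exact: within_continuousB.
pose P y := int_ (y) q.
pose th (x : R) := k * x - k * L / 2.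
(* Centring the phase at the midpoint confines it to [[- k L / 2, k L / 2]], strictly inside
   [(- pi / 2, pi / 2)]. *)
have th_cos x : 0 <= x <= L -> 0 < cos (th x).
  move=> /andP[x0 xL]; apply: cos_gt0_pihalf; rewrite /th.
  have : 0 <= k * x by rewrite mulr_ge0// ltW.
  have : k * x <= k * L by rewrite ler_pM2l.
  move=> ? ?; apply/andP; split; lra.
have dth (x : R) : is_derive x 1 th k.
  rewrite /th; apply: is_derive_eq; rewrite ?scaler0 ?scaler1; ring.
(* The tangent replaces the cotangent of the classical proof: since k L < pi it
   is regular on the whole closed interval, and its coefficient F ^ 2 vanishes
   at both endpoints. *)
pose H x := P x + (2 * k ^+ 2 * (phi x * F x) + k ^+ 3 * (F x ^+ 2 * tan (th x))).
pose dH x := (dphi x + k ^+ 2 * F x) ^+ 2 +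
  k ^+ 2 * (phi x + k * (F x * tan (th x))) ^+ 2.
have dHE x : x \in `]0, L[ -> is_derive x 1 H (dH x).
  rewrite in_itv/= => x0L.
  have d1 := dphiE _ x0L.
  have d2 : is_derive x 1 F (phi x) := is_derive_primitive _ _ _ cphi x0L.
  have d3 : is_derive x 1 P (q x) := is_derive_primitive _ _ _ cq x0L.
  have cth : cos (th x) != 0.
    by rewrite gt_eqF// th_cos//; case/andP: x0L => ? ?; rewrite !ltW.
  have d4 : is_derive x 1 (tan \o th) (k * (1 + tan (th x) ^+ 2)).
    rewrite -cos2_tan2//.
    have d5 := is_derive_tan cth.
    have := is_derive1_comp d5 (dth x); rewrite mulrC; exact.
  rewrite (_ : H = (P + ((2 * k ^+ 2) \*: (phi * F) +
      (k ^+ 3) \*: (F * F * (tan \o th))))); last first.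
    by apply/funext => y; rewrite /H !fctE.
  apply: (is_derive_eq (is_deriveD d3 (is_deriveD
    (is_deriveZ (2 * k ^+ 2) (is_deriveM d1 d2))
    (is_deriveZ (k ^+ 3) (is_deriveM (is_deriveM d2 d2) d4))))).
  rewrite /dH /q /GRing.scale/= !fctE.
  ring.
have cH : {within `[0, L], continuous H}.
  have cF : {within `[0, L], continuous F}.
    by apply: within_continuous_primitive => //; exact: ltW.
  have cP : {within `[0, L], continuous P}.
    by apply: within_continuous_primitive => //; exact: ltW.
  have ctan : {within `[0, L], continuous (tan \o th)}.
    apply: derivable_within_continuous => x; rewrite in_itv/= => x0L.
    have d5 := is_derive_tan (lt0r_neq0 (th_cos _ x0L)).
    by have [] := is_derive1_comp d5 (dth x).
  apply: within_continuousD => //; apply: within_continuousD.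
    apply: within_continuousM; first exact: within_continuous_cst.
    exact: within_continuousM.
  apply: within_continuousM; first exact: within_continuous_cst.
  by apply: within_continuousM => //; exact: within_continuousM.
have [c c0L] := MVT L0 dHE cH.
have F0 : F 0 = 0 by rewrite /F set_itv1 Rintegral_set1.
have P0 : P 0 = 0 by rewrite /P set_itv1 Rintegral_set1.
(* This is the mean-zero hypothesis, up to unfolding [F]. *)
have FL : F L = 0 by [].
have -> : H 0 = 0 by rewrite /H P0 F0; ring.
have -> : H L = P L by rewrite /H FL; ring.
rewrite !subr0 => PL.
have : 0 <= P L.
  by rewrite PL mulr_ge0 ?(ltW L0)// addr_ge0 ?sqr_ge0// mulr_ge0 ?sqr_ge0.
rewrite /P RintegralB//; [|exact: continuous_integrable_itv0..].
by rewrite subr_ge0 RintegralZl//; exact: continuous_integrable_itv0.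
Qed.

End Wirtinger.

(** * Means over the interval and the exact value of the Poincaré constant *)

Section PoincareConstant.
Context {R : realType} (L : R) (L0 : 0 < L).
Notation mu := (@lebesgue_measure R).

Lemma ge0_integral_uniform_itv (g : R -> \bar R) :
  measurable_fun `[0, L] g -> (forall x, 0 <= g x)%E ->
  (\int[uniform_prob L0]_(x in `[0%R, L]) g x =
   L^-1%:E * \int[mu]_(x in `[0%R, L]) g x)%E.
Proof.
move=> mg g0.
rewrite integral_mkcond integral_uniform; last 2 first.
- by apply/(measurable_restrictT _ _).1.
- by move=> x; rewrite erestrict_ge0.
rewrite subr0; congr (_ * _)%E.
by apply: eq_integral => x xD; rewrite patchE xD.
Qed.

(** The nonnegative case is applied to the positive and negative parts, whose integrals are finite,
    so their difference can be taken back to the reals. *)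
Lemma interval_meanE (f : R -> R) : {within `[0, L], continuous f} ->
  interval_mean L0 f = L^-1 * (\int[mu]_(x in `[0%R, L]) (f x))%R.
Proof.
move=> cf; have fi := continuous_integrable_itv0 _ _ cf.
have mf : measurable_fun `[0, L] (EFin \o f) by case/integrableP : fi.
rewrite /interval_mean /Rintegral integralE [in RHS]integralE.
rewrite !ge0_integral_uniform_itv; [|exact: measurable_funeneg|
  by []|exact: measurable_funepos|by []].
have fp : (\int[mu]_(x in `[0%R, L]) (EFin \o f)^\+ x)%E \is a fin_num.
  by apply: integrable_pos_fin_num.
have fn : (\int[mu]_(x in `[0%R, L]) (EFin \o f)^\- x)%E \is a fin_num.
  by apply: integrable_neg_fin_num.
rewrite -muleBr//; last by rewrite fin_num_adde_defr.
rewrite fineM// fin_numB fp; exact: fn.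
Qed.

Lemma interval_mean_derive (F f : R -> R) : continuous f ->
  (forall x : R, is_derive x 1 F (f x)) ->
  interval_mean L0 f = (F L - F 0) / L.
Proof.
move=> cf dF.
have cF : continuous F.
  by move=> x; apply: differentiable_continuous; apply/derivable1_diffP; case: (dF x).
have cf' : {within `[0, L], continuous f} by exact: continuous_subspaceT.
rewrite interval_meanE// mulrC /Rintegral.
rewrite (@continuous_FTC2 _ _ F)//.
- by split; [move=> x _; case: (dF x)|apply: cvg_at_right_filter; exact: cF|
    apply: cvg_at_left_filter; exact: cF].
- by move=> x _; rewrite derive1E; case: (dF x).
Qed.

Lemma interval_mean_cst (a : R) : interval_mean L0 (cst a) = a.
Proof.
have d (x : R) : is_derive x 1 (a \*: (id : R -> R)) (cst a x).
  by apply: (is_derive_eq (is_deriveZ a (is_derive_id x 1))); rewrite /GRing.scale/= mulr1.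
have c : continuous (cst a : R -> R) by move=> x; exact: cst_continuous.
rewrite (interval_mean_derive _ _ c d).
by rewrite /= scaler0 subr0 /GRing.scale/= mulfK// gt_eqF.
Qed.

Lemma interval_meanB (f g : R -> R) : {within `[0, L], continuous f} ->
  {within `[0, L], continuous g} ->
  interval_mean L0 (fun x => f x - g x) = interval_mean L0 f - interval_mean L0 g.
Proof.
move=> cf cg; rewrite !interval_meanE//; last exact: within_continuousB.
by rewrite RintegralB// ?mulrBr//; exact: continuous_integrable_itv0.
Qed.

(** Subtracting the mean leaves the derivative unchanged and reduces to the mean-zero inequality;
    the normalization [1 / L] cancels. *)
Lemma poincare_inequality_lt (k : R) (phi dphi : R -> R) : 0 < k -> k * L < pi ->
  C1_interval L phi dphi ->
  k ^+ 2 * interval_variance L0 phi <= interval_mean L0 (fun x => dphi x ^+ 2).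
Proof.
move=> k0 kL C1; have [cphi cdphi dphiE] := C1.
rewrite /interval_variance; set a := interval_mean L0 phi.
have cpsi : {within `[0, L], continuous (fun x => phi x - a)}.
  by apply: within_continuousB => //; exact: within_continuous_cst.
have C1' : C1_interval L (fun x => phi x - a) dphi.
  split => // x /dphiE d1.
  have d2 := is_deriveB d1 (is_derive_cst a x 1).
  by apply: (is_derive_eq d2); rewrite subr0.
have mean0 : (\int[mu]_(x in `[0%R, L]) (phi x - a))%R = 0.
  apply: (mulfI (invr_neq0 (lt0r_neq0 L0))); rewrite mulr0 -interval_meanE//.
  rewrite interval_meanB//; last exact: within_continuous_cst.
  by rewrite (interval_mean_cst a) subrr.
have W := wirtinger_lt _ _ _ _ L0 k0 kL C1' mean0.
rewrite !interval_meanE//; [|exact: within_continuousM..].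
by rewrite mulrCA ler_pM2l// invr_gt0.
Qed.

(** For the upper bound, [cos (k x)] has variance [1 / 2] and mean squared derivative [k ^ 2 / 2].
    For the lower bound, all positive constants strictly below [k ^ 2] are admissible, and the
    supremum recovers [k ^ 2]. *)
Lemma poincare_constantE : poincare_constant L0 = (pi ^+ 2 / L ^+ 2)%:E.
Proof.
rewrite -expr_div_n; set k := pi / L.
have k0 : 0 < k by rewrite divr_gt0// pi_gt0.
have kL : k * L = pi by rewrite divfK// gt_eqF.
apply/eqP; rewrite eq_le; apply/andP; split.
  apply: ge_ereal_sup => _ [c cP <-]; rewrite lee_fin.
  pose th (x : R) := k * x.
  have dth (x : R) : is_derive x 1 th k.
    by apply: is_derive_eq; rewrite /GRing.scale/=; ring.
  have dcos (x : R) : is_derive x 1 (cos \o th) (- k * sin (th x)).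
    by apply: (is_derive_eq (is_derive1_comp (is_derive_cos (th x)) (dth x))); ring.
  have dsin (x : R) : is_derive x 1 (sin \o th) (k * cos (th x)).
    by apply: (is_derive_eq (is_derive1_comp (is_derive_sin (th x)) (dth x))); ring.
  have cth : continuous th.
    exact: mulrl_continuous.
  have ccos : continuous (cos \o th).
    by move=> x; apply: continuous_comp; [exact: cth|exact: continuous_cos].
  have csin : continuous (sin \o th).
    by move=> x; apply: continuous_comp; [exact: cth|exact: continuous_sin].
  have thL : th L = pi by [].
  have th0 : th 0 = 0 by rewrite /th mulr0.
  have mcos : interval_mean L0 (cos \o th) = 0.
    have d (x : R) : is_derive x 1 (k^-1 \*: (sin \o th)) ((cos \o th) x).
      apply: (is_derive_eq (is_deriveZ k^-1 (dsin x))).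
      by rewrite /GRing.scale/= mulKf// gt_eqF.
    by rewrite (interval_mean_derive _ _ ccos d)/= thL th0 sinpi sin0 subrr mul0r.
  have dsc (x : R) : is_derive x 1 ((sin \o th) * (cos \o th))
      (k * (cos (th x) ^+ 2 - sin (th x) ^+ 2)).
    by apply: (is_derive_eq (is_deriveM (dsin x) (dcos x)));
      rewrite /GRing.scale/=; ring.
  have mcos2 : interval_mean L0 (fun x => cos (th x) ^+ 2) = 2^-1.
    have d (x : R) : is_derive x 1
        (2^-1 \*: (id + k^-1 \*: ((sin \o th) * (cos \o th)))) (cos (th x) ^+ 2).
      apply: (is_derive_eq (is_deriveZ 2^-1
        (is_deriveD (is_derive_id x 1) (is_deriveZ k^-1 (dsc x))))).
      rewrite sin2cos2 /GRing.scale/=; field; exact: lt0r_neq0.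
    have cc : continuous (fun x => cos (th x) ^+ 2).
      by move=> x; exact: (cvgM (ccos x) (ccos x)).
    rewrite (interval_mean_derive _ _ cc d) !fctE/= thL th0 sinpi sin0 !mul0r.
    by rewrite /GRing.scale/= !(mulr0, addr0, subr0) mulfK// gt_eqF.
  have msin2 : interval_mean L0 (fun x => (- k * sin (th x)) ^+ 2) = k ^+ 2 / 2.
    have d (x : R) : is_derive x 1
        ((k ^+ 2 / 2) \*: (id - k^-1 \*: ((sin \o th) * (cos \o th))))
        ((- k * sin (th x)) ^+ 2).
      apply: (is_derive_eq (is_deriveZ (k ^+ 2 / 2)
        (is_deriveB (is_derive_id x 1) (is_deriveZ k^-1 (dsc x))))).
      rewrite cos2sin2 /GRing.scale/=; field; exact: lt0r_neq0.
    have cc : continuous (fun x => (- k * sin (th x)) ^+ 2).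
      have cs : continuous (fun x => - k * sin (th x)).
        by move=> x; apply: cvgM; [exact: cvg_cst|exact: csin].
      by move=> x; exact: (cvgM (cs x) (cs x)).
    rewrite (interval_mean_derive _ _ cc d) !fctE/= thL th0 sinpi sin0 !mul0r.
    by rewrite /GRing.scale/= !(mulr0, addr0, subr0) mulfK// gt_eqF.
  have := cP (cos \o th) (fun x => - k * sin (th x)).
  rewrite msin2 /interval_variance mcos.
  rewrite (_ : interval_mean _ _ = 2^-1); last first.
    rewrite -mcos2; congr interval_mean; apply/funext => x /=.
    by rewrite subr0.
  rewrite ler_pM2r ?invr_gt0//; apply; split.
  - exact: continuous_subspaceT.
  - apply: within_continuousM; first exact: within_continuous_cst.
    exact: continuous_subspaceT.
  - by move=> x _; exact: dcos.
apply/lee_addgt0Pr => e e0.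
(* The second entry keeps [c] positive when [e] is large, so that its square root is a legitimate
   frequency. *)
pose c := Num.max (k ^+ 2 - e) (k ^+ 2 / 2).
have k20 : 0 < k ^+ 2 by rewrite exprn_gt0.
have c0 : 0 < c by rewrite lt_max divr_gt0// orbT.
have ck : c < k ^+ 2 by rewrite gt_max; apply/andP; split; lra.
apply: (@le_trans _ _ (c%:E + e%:E)%E).
  by rewrite -EFinD lee_fin -lerBlDr le_max lexx.
apply: leeD2r; apply: ereal_sup_ubound; exists c => // phi dphi C1.
rewrite -(sqr_sqrtr (ltW c0)); apply: poincare_inequality_lt => //.
  by rewrite sqrtr_gt0.
rewrite -kL ltr_pM2r// -(ltr_pXn2r (_ : 0 < 2)%N) ?nnegrE ?sqrtr_ge0 ?(ltW k0)//.
by rewrite sqr_sqrtr// ltW.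
Qed.

End PoincareConstant.

(** * The Gaussian measure through its density *)

Section GaussianDensity.
Context {R : realType}.
Notation mu := (@lebesgue_measure R).
Notation kappa := (@normal_prob R 0 1).

(** The Radon-Nikodym derivative agrees a.e. with [normal_pdf], since both have the same integral
    over every measurable set. *)
Lemma ge0_integral_normal_prob (g : R -> \bar R) :
  measurable_fun setT g -> (forall x, 0 <= g x)%E ->
  (\int[kappa]_x g x = \int[mu]_x (g x * (normal_pdf 0 1 x)%:E))%E.
Proof.
move=> mg g0; have kmu := normal_prob_dominates 0 (1 : R).
have mrn : measurable_fun setT (Radon_Nikodym_SigmaFinite.f kappa mu).
  exact: measurable_int (Radon_Nikodym_SigmaFinite.f_integrable kmu).
have mpdf : measurable_fun setT (fun x : R => (normal_pdf 0 1 x)%:E).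
  by apply/measurable_EFinP; exact: measurable_normal_pdf.
rewrite -(Radon_Nikodym_SigmaFinite.change_of_variables kmu)//.
apply: ae_eq_integral => //; [exact: emeasurable_funM..|].
apply: ae_eqe_mul2l; apply: integral_ae_eq => //.
  exact: Radon_Nikodym_SigmaFinite.f_integrable.
by move=> A _ mA; rewrite -Radon_Nikodym_SigmaFinite.f_integral.
Qed.

(** The density is strictly positive, so a set on which its integral vanishes is Lebesgue-null. *)
Lemma normal_prob_gt0 (A : set (measurableTypeR R)) : measurable A ->
  (0 < mu A)%E -> (0 < kappa A)%E.
Proof.
move=> mA muA; rewrite lt_neqAle measure_ge0 andbT eq_sym.
apply/eqP => kA0.
have mpdf : measurable_fun A (fun x : R => (normal_pdf 0 1 x)%:E).
  by apply/measurable_funTS/measurable_EFinP; exact: measurable_normal_pdf.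
have : (\int[mu]_(x in A) `|(normal_pdf 0 1 x)%:E| = 0)%E.
  rewrite -kA0; apply: eq_integral => x _.
  by rewrite gee0_abs// lee_fin normal_pdf_ge0.
move/(ae_eq_integral_abs mu mA mpdf) => ae0.
have : mu.-negligible A.
  apply: negligibleS ae0 => x Ax /= /(_ Ax) [] /eqP.
  by rewrite normal_pdfE ?oner_eq0// gt_eqF// mulr_gt0 ?expR_gt0// normal_peak_gt0 ?oner_eq0.
by move/(measure_negligible mA) => muA0; rewrite muA0 ltxx in muA.
Qed.

(** The integrand is dominated by a multiple of the Gaussian density of standard deviation 2, whose
    slower decay absorbs the quartic polynomial. *)
Lemma normal_prob_hermite2_sqr_lty :
  (\int[kappa]_v ((v ^+ 2 - 1) ^+ 2)%:E < +oo)%E.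
Proof.
rewrite ge0_integral_normal_prob//; last 2 first.
- apply/measurable_EFinP; apply: measurable_funX.
  by apply: measurable_funB => //; exact: measurable_funX.
- by move=> x; rewrite lee_fin sqr_ge0.
(* The factor 32 gives [(v ^ 2 - 1) ^ 2 <= 32 (1 + y) ^ 2] for [y = 3 v ^ 2 / 16], as
   [32 * 9 / 256 > 1]. *)
pose c : R := 32 * (normal_peak 1 / normal_peak 2).
have p2 : 0 < normal_peak (2 : R) by rewrite normal_peak_gt0.
have p1 : 0 <= normal_peak (1 : R) by exact: normal_peak_ge0.
apply: (@le_lt_trans _ _ (\int[mu]_v (c%:E * (normal_pdf 0 2 v)%:E))%E).
  apply: ge0_le_integral => //.
  - by move=> x _; rewrite -EFinM lee_fin mulr_ge0 ?sqr_ge0 ?normal_pdf_ge0.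
  - apply/measurable_EFinP; apply: measurable_funM.
      apply: measurable_funX.
      by apply: measurable_funB => //; exact: measurable_funX.
    exact: measurable_normal_pdf.
  - apply/measurable_EFinP; apply: measurable_funM => //.
    exact: measurable_normal_pdf.
  move=> v _; rewrite -!EFinM lee_fin !normal_pdfE ?oner_eq0//.
  rewrite /c /normal_fun subr0.
  have -> : 32 * (normal_peak 1 / normal_peak 2) *
      (normal_peak 2 * expR (- v ^+ 2 / (2 ^+ 2 *+ 2))) =
      normal_peak 1 * (32 * expR (- v ^+ 2 / (2 ^+ 2 *+ 2))).
    by field; rewrite gt_eqF.
  rewrite mulrCA ler_wpM2l//.
  (* The two Gaussian exponents differ by [2 y]; squaring [1 + y <= exp y] then yields a quartic
     lower bound. *)
  pose y := 3 / 16 * v ^+ 2.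
  have -> : - v ^+ 2 / (1 ^+ 2 *+ 2) = - v ^+ 2 / (2 ^+ 2 *+ 2) - (y + y).
    by rewrite /y; field.
  rewrite expRB mulrCA [leRHS]mulrC ler_wpM2l ?expR_ge0//.
  rewrite ler_pdivrMr ?expR_gt0// expRD.
  have y0 : 0 <= y by rewrite mulr_ge0 ?sqr_ge0.
  have y1 : 1 + y <= expR y := expR_ge1Dx y.
  have : (1 + y) * (1 + y) <= expR y * expR y by rewrite ler_pM// addr_ge0.
  have : 0 <= v ^+ 2 * v ^+ 2 by rewrite mulr_ge0 ?sqr_ge0.
  rewrite /y; have := sqr_ge0 v; nra.
rewrite integralZl//; last exact: integrable_normal_pdf.
by rewrite integral_normal_pdf mule1 ltry.
Qed.

End GaussianDensity.

(** * Partial derivatives, and invariance under subtraction of constants *)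

Section PartialDerivatives.
Context {R : realType}.
Implicit Types (f : R * R -> R) (p : R * R).

Lemma is_derive_fst f p d :
  is_derive p.1 1 (fun x => f (x, p.2)) d -> is_derive p (1, 0) f d.
Proof.
have E : (fun h : R => h^-1 *: ((f \o shift p) (h *: ((1, 0) : R * R)) - f p)) =
    (fun h => h^-1 *: (((fun x => f (x, p.2)) \o shift p.1) (h *: 1) - f (p.1, p.2))).
  apply/funext => h; case: p => x y /=; congr (_ *: (f _ - _)).
  by transitivity (h * 1 + x, h * 0 + y) => //; rewrite mulr0 add0r.
case=> d1 d2; apply: DeriveDef.
  by rewrite /derivable E.
by rewrite -d2 /derive E.
Qed.

Lemma is_derive_snd f p d :
  is_derive p.2 1 (fun y => f (p.1, y)) d -> is_derive p (0, 1) f d.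
Proof.
have E : (fun h : R => h^-1 *: ((f \o shift p) (h *: ((0, 1) : R * R)) - f p)) =
    (fun h => h^-1 *: (((fun y => f (p.1, y)) \o shift p.2) (h *: 1) - f (p.1, p.2))).
  apply/funext => h; case: p => x y /=; congr (_ *: (f _ - _)).
  by transitivity (h * 0 + x, h * 1 + y) => //; rewrite mulr0 add0r.
case=> d1 d2; apply: DeriveDef.
  by rewrite /derivable E.
by rewrite -d2 /derive E.
Qed.

Lemma derive_subr_cst f (m : R) (v p : R * R) :
  'D_v (fun p => f p - m) p = 'D_v f p.
Proof.
rewrite /derive.
have -> // : (fun h : R => h^-1 *: (((fun p => f p - m) \o shift p) (h *: v) -
      (f p - m))) = (fun h => h^-1 *: ((f \o shift p) (h *: v) - f p)).
apply/funext => h; congr (_ *: _) => /=; ring.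
Qed.

Lemma kfp_operator_subr_cst (gamma m : R) f :
  kfp_operator gamma (fun p => f p - m) = kfp_operator gamma f.
Proof.
have E : 'D_(0, 1) (fun p => f p - m) = 'D_(0, 1) f.
  by apply/funext => p; rewrite derive_subr_cst.
by apply/funext => p; rewrite /kfp_operator E !derive_subr_cst.
Qed.

(** Allows an eigenfunction to be recentred to mean zero. Only the entry of order zero in the
    derivative family changes, and its bound absorbs [m] because the weight is at least 1. *)
Lemma specular_class_subr_cst (L m : R) f :
  specular_class L f -> specular_class L (fun p => f p - m).
Proof.
case=> bc [D [D0 Dc Dd] [N N0 DN]]; split.
  by move=> v; have [-> ->] := bc v.
pose D' i j := if (i + j == 0)%N then (fun p => D 0%N 0%N p - m) else D i j.
exists D'.
  split.
  - by move=> p sp; rewrite /D'/= D0.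
  - move=> i j ij; rewrite /D'; case: ifP => _; last exact: Dc.
    move=> p; apply: cvgB; last exact: cvg_cst.
    by apply: Dc.
  - move=> i j ij p op; have [d1 d2] := Dd i j ij p op.
    rewrite /D' addSn addnS/=; case: ifPn => // ij0.
    have [i0 j0] : i = 0%N /\ j = 0%N by case: i j ij0 {ij d1 d2} => [|i] [|j].
    subst i j; split.
      by apply: (is_derive_eq (is_deriveB d1 (is_derive_cst m p _))); rewrite subr0.
    by apply: (is_derive_eq (is_deriveB d2 (is_derive_cst m p _))); rewrite subr0.
exists N => // i j ij; rewrite /D'; case: ifP => _; last exact: DN.
have [C CP] := DN 0%N 0%N isT.
exists (C + `|m|) => p sp; rewrite mulrDl (le_trans (ler_normB _ _))// lerD ?CP//.
rewrite ler_peMr// -[leLHS](powRr0 (1 + `|p.2|)) ler_powR ?lerDl//.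
exact: ltW.
Qed.

End PartialDerivatives.

(** * From classical eigenfunctions to bounds on the decay rate *)

Section Eigenfunctions.
Context {R : realType} (L : R) (L0 : 0 < L).
Notation mu := (phase_measure L0).

Lemma uniform_prob_itv_gt0 (a b : R) : 0 <= a -> a < b -> b <= L ->
  (0 < uniform_prob L0 `]a, b[)%E.
Proof.
move=> a0 ab bL; rewrite /uniform_prob.
rewrite (eq_integral (fun=> (L^-1)%:E)); last first.
  move=> x; rewrite inE/= in_itv/= => /andP[ax xb].
  by rewrite /uniform_pdf subr0 (le_trans a0 (ltW ax)) (le_trans (ltW xb) bL).
rewrite integral_cst//= lebesgue_measure_itv/= lte_fin ab -EFinD -EFinM lte_fin.
by rewrite mulr_gt0 ?invr_gt0// subr_gt0.
Qed.

(** By continuity [f] is nonzero on a small square around [p], and such a square has positive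
    product measure. *)
Lemma not_ae_eq0 (f : R * R -> R) p : continuous f -> 0 < p.1 < L -> f p != 0 ->
  ~ (f = 0 %[ae mu]).
Proof.
move=> cf /andP[p0 pL] fp0 f0.
have : \forall q \near p, f q != 0.
  have n0 : nbhs (f p) [set y : R | y != 0].
    by apply: open_nbhs_nbhs; split => //; exact: open_neq.
  exact: (cf p _ n0).
move=> /nbhs_ballP[e /= e0 eP].
(* The last two entries keep the horizontal side within [[0, L]], where the uniform density is
   [1 / L]. *)
pose d := Num.min e (Num.min p.1 (L - p.1)).
have d0 : 0 < d by rewrite !lt_min e0 p0 subr_gt0 pL.
have [de dp dL] : [/\ d <= e, d <= p.1 & d <= L - p.1].
  by split; rewrite /d !ge_min lexx ?orbT.
pose A : set (measurableTypeR R) := [set` `]p.1 - d, p.1 + d[].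
pose B : set (measurableTypeR R) := [set` `]p.2 - d, p.2 + d[].
have mA : measurable A by exact: measurable_itv.
have mB : measurable B by exact: measurable_itv.
have : mu.-negligible (A `*` B).
  apply: negligibleS f0 => -[x y] /= [].
  rewrite /A/= in_itv/= => /andP[xA1 xA2].
  rewrite /B/= in_itv/= => /andP[yB1 yB2] /(_ I).
  apply/eqP/(eP (x, y)); split; rewrite /ball/= ltr_distlC;
    apply/andP; split; lra.
move/(measure_negligible (measurableX mA mB)) => AB0.
have /esym/eqP := phase_measureX _ L0 _ _ mA mB.
rewrite [X in _ == X]AB0 mule_eq0 => /orP[]; apply/negP.
  rewrite gt_eqF//; apply: uniform_prob_itv_gt0; lra.
rewrite gt_eqF//; apply: normal_prob_gt0 => //.
rewrite lebesgue_measure_itv/= lte_fin ifT; last lra.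
rewrite -EFinD lte_fin; lra.
Qed.

Lemma bounded_Lfun2 (f : measurableTypeR R * measurableTypeR R -> R) (M : R) :
  measurable_fun setT f -> (forall p, `|f p| <= M) -> f \in Lfun mu 2%:E.
Proof.
move=> mf fM; rewrite inE/=; apply/andP; split; rewrite inE//=.
rewrite /finite_norm unlock poweR_lty//.
apply: (@le_lt_trans _ _ (\int[mu]_x (M `^ 2)%:E)%E).
  apply: ge0_le_integral => //=.
  - apply/measurable_EFinP.
    apply/(@measurableT_comp _ _ _ _ _ _ (fun x : R => x `^ 2)%R) => //.
    exact: measurableT_comp.
  - move=> p _; rewrite lee_fin ge0_ler_powR// ?nnegrE ?fM//.
    exact: (le_trans _ (fM p)).
by rewrite integral_cst//= phase_measure_setT mule1 ltry.
Qed.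

Lemma optimal_rate_le_of_eigenfunction (gamma r : R) (S : R -> L2fun L0 -> L2fun L0)
    (f : R * R -> R) p :
  well_posed gamma S -> 0 < r -> specular_class L f -> f \in Lfun mu 2%:E ->
  (forall q, kfp_operator gamma f q = - r * f q) ->
  continuous f -> 0 < p.1 < L -> f p != 0 ->
  (optimal_decay_rate S <= r%:E)%E.
Proof.
move=> WP r0 fC f2 fE cf pL fp.
pose u0 : L2fun L0 := Lfun_Sub (lee1n 2) f2.
(* The mean is subtracted to enter [specular_class0]; the operator annihilates constants, so the
   generator still yields [- r f]. *)
pose m := (\int[mu]_q u0 q)%R.
have m2 : cst m \in Lfun mu 2%:E.
  by apply: (@bounded_Lfun2 _ `|m|) => //; exact: measurable_cst.
pose u := u0 - Lfun_Sub (lee1n 2) m2.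
have uE q : u q = f q - m by [].
have f'C := specular_class_subr_cst _ m _ fC.
have uf : u = (fun q => f q - m) %[ae mu] by apply: aeW => q _.
have u20 : L20 u.
  rewrite /L20 /=; transitivity ((\int[mu]_q (u0 q - cst m q))%R) => //.
  rewrite RintegralB//; [|exact: L2fun_integrable|
    exact: (L2fun_integrable _ _ (Lfun_Sub (lee1n 2) m2))].
  rewrite Rintegral_cst//= phase_measure_setT/= mulr1; exact: subrr.
have u_class : specular_class0 u by split => //; exists (fun q => f q - m).
have [w Suw] := wp_class_domain WP u_class.
have wE : w = - r *: u0 %[ae mu].
  have := wp_generator WP u_class Suw f'C uf.
  rewrite kfp_operator_subr_cst; apply: filterS => q /(_ I) -> _.
  by rewrite fE.
(* The generator takes values in L^2_0, so an eigenfunction of the differential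
   operator automatically has mean zero. *)
have m0 : m = 0.
  have [_ w0 _] := Suw.
  have : (\int[mu]_q (- r *: u0) q)%R = 0.
    rewrite -[RHS]w0 /Rintegral; congr fine; apply: ae_eq_integral => //.
    - by apply/measurable_EFinP.
    - by apply/measurable_EFinP.
    - by apply: filterS wE => q /(_ I) /= -> _.
  rewrite RintegralZl//; last exact: L2fun_integrable.
  by move/eqP; rewrite mulf_eq0 oppr_eq0 gt_eqF//= => /eqP.
have wru : w = - r *: u %[ae mu].
  by apply: filterS wE => q /(_ I) -> _; rewrite !L2funZE uE m0 subr0.
apply: (optimal_rate_le_of_eigenvector _ _ _ _ WP _ _ _ r0 Suw wru).
rewrite lt_neqAle l2norm_ge0 andbT eq_sym; apply/eqP => /l2norm_eq0 uz.
apply: (not_ae_eq0 _ _ cf pL fp).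
by apply: filterS uz => q /(_ I) + _; rewrite uE m0 subr0.
Qed.

End Eigenfunctions.

(** * The plane wave, giving the bound [m / gamma] *)

Section PlaneWave.
Context {R : realType}.
Context (L gamma k : R) (L0 : 0 < L) (gamma0 : 0 < gamma) (k0 : 0 < k).

Implicit Types (i j : nat) (p q : R * R).

(** Each derivative of the cosine advances its phase by [pi / 2], so one formula covers all partial
    derivatives of [cos (k (x + v / gamma))]. *)
Definition plane_wave (i j : nat) (p : R * R) : R :=
  k ^+ i * (k / gamma) ^+ j *
    cos (k * p.1 + k / gamma * p.2 + (i + j)%:R * (pi / 2)).

Lemma is_derive_cos_affine (c a b x : R) :
  is_derive x 1 (fun y => c * cos (a * y + b)) (c * a * cos (a * x + b + pi / 2)).
Proof.
pose g (y : R) := a * y + b.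
have d1 : is_derive x 1 g a.
  have d := is_deriveD (is_deriveZ a (is_derive_id x 1)) (is_derive_cst b x 1).
  by apply: (is_derive_eq d); rewrite addr0 /GRing.scale/= mulr1.
have d2 := is_deriveZ c (is_derive1_comp (is_derive_cos (g x)) d1).
by apply: (is_derive_eq d2); rewrite cosDpihalf /GRing.scale/= /g; ring.
Qed.

Lemma plane_wave_dx i j p :
  is_derive p (1, 0) (plane_wave i j) (plane_wave i.+1 j p).
Proof.
apply: is_derive_fst; rewrite /plane_wave /=.
pose c := k ^+ i * (k / gamma) ^+ j.
pose b := k / gamma * p.2 + (i + j)%:R * (pi / 2).
have d := is_derive_cos_affine c k b p.1.
rewrite (_ : (fun x => _) = (fun y => c * cos (k * y + b))); last first.
  by apply/funext => y; rewrite /b addrA.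
apply: (is_derive_eq d); rewrite /c /b exprS addSn -[(_ + _).+1]addn1 natrD.
congr (_ * cos _); ring.
Qed.

Lemma plane_wave_dv i j p :
  is_derive p (0, 1) (plane_wave i j) (plane_wave i j.+1 p).
Proof.
apply: is_derive_snd; rewrite /plane_wave /=.
pose c := k ^+ i * (k / gamma) ^+ j.
pose b := k * p.1 + (i + j)%:R * (pi / 2).
have d := is_derive_cos_affine c (k / gamma) b p.2.
rewrite (_ : (fun x => _) = (fun y => c * cos (k / gamma * y + b))); last first.
  by apply/funext => y; rewrite /b; congr (_ * cos _); ring.
apply: (is_derive_eq d); rewrite /c /b exprS addnS -[(_ + _).+1]addn1 natrD.
congr (_ * cos _); ring.
Qed.

Lemma continuous_plane_wave i j : continuous (plane_wave i j).
Proof.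
move=> p; apply: cvgM; first exact: cvg_cst.
apply: (cvg_comp _ cos); last exact: continuous_cos.
apply: cvgD; last exact: cvg_cst.
apply: cvgD; apply: cvgM; [exact: cvg_cst|exact: cvg_fst|exact: cvg_cst|
  exact: cvg_snd].
Qed.

Lemma plane_wave_bounded i j p :
  `|plane_wave i j p| <= k ^+ i * (k / gamma) ^+ j.
Proof.
have c0 : 0 <= k ^+ i * (k / gamma) ^+ j.
  by rewrite mulr_ge0// exprn_ge0 ?divr_ge0 ?(ltW k0) ?(ltW gamma0).
by rewrite normrM (ger0_norm c0) ler_piMr// cos_max.
Qed.

(** At [x = 0] the cosine is even in [v]; at [x = L] the phase is [pi + k v / gamma], and
    [cos (pi + t) = cos (pi - t)]. *)
Lemma specular_plane_wave : k * L = pi -> specular_class L (plane_wave 0 0).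
Proof.
move=> kL; split.
  move=> v; rewrite /plane_wave/= kL !mul0r !addr0 !mulr0 !add0r mulrN cosN.
  split=> //; congr (_ * _).
  by rewrite -[LHS]cosN -[LHS](cosD2pi) opprD; congr cos; ring.
exists plane_wave.
  split => //.
  - by move=> i j _; apply: continuous_subspaceT; exact: continuous_plane_wave.
  - by move=> i j _ p _; split; [exact: plane_wave_dx|exact: plane_wave_dv].
exists 1 => // i j _; exists (k ^+ i * (k / gamma) ^+ j) => p _.
apply: (le_trans (plane_wave_bounded i j p)).
rewrite powRr1 ?addr_ge0// ler_peMr ?lerDl//.
by rewrite mulr_ge0// exprn_ge0 ?divr_ge0 ?(ltW k0) ?(ltW gamma0).
Qed.

(** Along functions of [x + v / gamma], transport and friction drift cancel; diffusion alone
    contributes, with [gamma (k / gamma) ^ 2 = k ^ 2 / gamma]. *)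
Lemma kfp_plane_wave p :
  kfp_operator gamma (plane_wave 0 0) p = - (k ^+ 2 / gamma) * plane_wave 0 0 p.
Proof.
have dx q : 'D_(1, 0) (plane_wave 0 0) q = plane_wave 1 0 q.
  by case: (plane_wave_dx 0 0 q).
have dv q : 'D_(0, 1) (plane_wave 0 0) q = plane_wave 0 1 q.
  by case: (plane_wave_dv 0 0 q).
have dvE : 'D_(0, 1) (plane_wave 0 0) = plane_wave 0 1 by exact/funext.
have dvv q : 'D_(0, 1) (plane_wave 0 1) q = plane_wave 0 2 q.
  by case: (plane_wave_dv 0 1 q).
rewrite /kfp_operator dvE dx dv dvv /plane_wave !addn0 !add0n.
rewrite !mul1r mul0r addr0 cosDpihalf.
rewrite (_ : 2%:R * (pi / 2) = pi / 2 + pi / 2); last by field.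
rewrite addrA !cosDpihalf sinDpihalf !expr0 !expr1.
by field; rewrite gt_eqF.
Qed.

Lemma measurable_plane_wave : measurable_fun
  [set: measurableTypeR R * measurableTypeR R] (plane_wave 0 0).
Proof.
apply: measurable_funM => //.
apply: measurableT_comp; first exact: continuous_measurable_fun (@continuous_cos R).
apply: measurable_funD => //; apply: measurable_funD; apply: measurable_funM => //.
Qed.

Lemma optimal_rate_le_wave (S : R -> L2fun L0 -> L2fun L0) :
  well_posed gamma S -> k * L = pi ->
  (optimal_decay_rate S <= (k ^+ 2 / gamma)%:E)%E.
Proof.
move=> WP kL.
(* At this point the phase is [k L / 2 + k L / 2 = pi], so the wave takes the value [- 1]. *)
apply: (@optimal_rate_le_of_eigenfunction _ _ L0 gamma (k ^+ 2 / gamma) S (plane_wave 0 0)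
  (L / 2, gamma * (L / 2))) => //.
- by rewrite divr_gt0// exprn_gt0.
- exact: specular_plane_wave.
- apply: (@bounded_Lfun2 _ _ _ _ 1); first exact: measurable_plane_wave.
  by move=> p; rewrite (le_trans (plane_wave_bounded _ _ _))// !expr0 mulr1.
- exact: kfp_plane_wave.
- exact: continuous_plane_wave.
- by rewrite /= divr_gt0//= ltr_pdivrMr// ltr_pMr// ltr1n.
rewrite /plane_wave/= (_ : _ + _ = pi) ?cospi ?expr0.
  by rewrite !mul1r oppr_eq0 oner_eq0.
by rewrite mul0r addr0 -kL; field; rewrite gt_eqF.
Qed.

End PlaneWave.

(** * The second Hermite polynomial in velocity, giving the bound [2 gamma] *)

Section Hermite.
Context {R : realType} (L gamma : R) (L0 : 0 < L) (gamma0 : 0 < gamma).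

Implicit Types (i j : nat) (p q : R * R).

Definition hermite2 (i j : nat) (p : R * R) : R :=
  match i, j with
  | 0%N, 0%N => p.2 ^+ 2 - 1
  | 0%N, 1%N => 2 * p.2
  | 0%N, 2%N => 2
  | _, _ => 0
  end.

Lemma hermite2_dx i j p : is_derive p (1, 0) (hermite2 i j) (hermite2 i.+1 j p).
Proof.
apply: is_derive_fst.
by case: i j => [|i] [|[|[|j]]]; rewrite /hermite2/=; exact: is_derive_cst.
Qed.

Lemma hermite2_dv i j p : (i + j < 2)%N ->
  is_derive p (0, 1) (hermite2 i j) (hermite2 i j.+1 p).
Proof.
move=> ij; apply: is_derive_snd.
case: i j ij => [|[|//]] [|[|//]] //= _; last exact: is_derive_cst.
  have d := is_deriveB (is_deriveM (is_derive_id p.2 1) (is_derive_id p.2 1))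
    (is_derive_cst (1 : R) p.2 1).
  by apply: (is_derive_eq d); rewrite /GRing.scale/=; ring.
apply: (is_derive_eq (is_deriveZ (2 : R) (is_derive_id p.2 1))).
by rewrite /GRing.scale/= mulr1.
Qed.

Lemma continuous_hermite2 i j : continuous (hermite2 i j).
Proof.
case: i j => [|i] [|[|[|j]]] p; try exact: cvg_cst.
  apply: cvgB; last exact: cvg_cst.
  by apply: cvgM; exact: cvg_snd.
by apply: cvgM; [exact: cvg_cst|exact: cvg_snd].
Qed.

Lemma specular_hermite2 : specular_class L (hermite2 0 0).
Proof.
split; first by move=> v; rewrite /= sqrrN.
exists hermite2.
  split => //.
  - by move=> i j _; apply: continuous_subspaceT; exact: continuous_hermite2.
  - by move=> i j ij p _; split; [exact: hermite2_dx|exact: hermite2_dv].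
exists 2 => // i j _; exists 2 => p _.
rewrite powR_mulrn ?addr_ge0//.
have := normr_ge0 p.2; have := real_normK (num_real p.2).
set a := `|p.2| => a2 a0.
have b0 : 0 <= 2 * (1 + a) ^+ 2 by rewrite mulr_ge0 ?sqr_ge0.
case: i j => [|i] [|[|[|j]]]; rewrite /hermite2 ?normr0//.
- rewrite (le_trans (ler_normB _ _))// normr1 normrX -/a; nra.
- rewrite normrM (ger0_norm (ler0n _ _)) -/a; nra.
- rewrite (ger0_norm (ler0n _ _)); nra.
Qed.

(** Transport vanishes and the velocity part is [- v (2 v) + 2 = - 2 (v ^ 2 - 1)]. *)
Lemma kfp_hermite2 p :
  kfp_operator gamma (hermite2 0 0) p = - (2 * gamma) * hermite2 0 0 p.
Proof.
have dx q : 'D_(1, 0) (hermite2 0 0) q = hermite2 1 0 q.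
  by case: (hermite2_dx 0 0 q).
have dv q : 'D_(0, 1) (hermite2 0 0) q = hermite2 0 1 q.
  by case: (hermite2_dv 0 0 q isT).
have dvE : 'D_(0, 1) (hermite2 0 0) = hermite2 0 1 by exact/funext.
have dvv q : 'D_(0, 1) (hermite2 0 1) q = hermite2 0 2 q.
  by case: (hermite2_dv 0 1 q isT).
rewrite /kfp_operator dvE dx dv dvv /=; ring.
Qed.

(** Tonelli's theorem reduces the squared norm to the Gaussian integral in [v], constant in [x]. *)
Lemma Lfun_hermite2 : hermite2 0 0 \in Lfun (phase_measure L0) 2%:E.
Proof.
have mh : measurable_fun [set: measurableTypeR R] (fun v : R => v ^+ 2 - 1).
  by apply: measurable_funB => //; exact: measurable_funX.
have mh2 : measurable_fun [set: measurableTypeR R * measurableTypeR R] (hermite2 0 0).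
  apply: measurableT_comp mh _; exact: measurable_snd.
rewrite inE/=; apply/andP; split; rewrite inE//=.
rewrite /finite_norm unlock poweR_lty//.
apply: (@le_lt_trans _ _ (\int[phase_measure L0]_p (hermite2 0 0 p ^+ 2)%:E)%E).
  rewrite le_eqVlt; apply/orP; left; apply/eqP; apply: eq_integral => p _ /=.
  by rewrite powR_mulrn// real_normK// num_real.
rewrite /phase_measure fubini_tonelli1//; last 2 first.
- by apply/measurable_EFinP; exact: measurable_funX.
- by move=> p; rewrite lee_fin sqr_ge0.
rewrite /fubini_F /=.
set c := (\int[normal_prob 0 1]_y _)%E.
have c_fin : c \is a fin_num.
  rewrite ge0_fin_numE ?normal_prob_hermite2_sqr_lty//.
  by apply: integral_ge0 => x _; rewrite lee_fin sqr_ge0.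
clearbody c; rewrite -(fineK c_fin) integral_cst//.
have U1 : uniform_prob L0 setT = 1%E by exact: probability_setT.
by rewrite [X in (_ * X)%E]U1 mule1 ltry.
Qed.

Lemma optimal_rate_le_hermite (S : R -> L2fun L0 -> L2fun L0) :
  well_posed gamma S -> (optimal_decay_rate S <= (2 * gamma)%:E)%E.
Proof.
move=> WP.
apply: (@optimal_rate_le_of_eigenfunction _ _ L0 gamma (2 * gamma) S (hermite2 0 0)
  (L / 2, 0)) => //.
- by rewrite mulr_gt0.
- exact: specular_hermite2.
- exact: Lfun_hermite2.
- exact: kfp_hermite2.
- exact: continuous_hermite2.
- by rewrite /= divr_gt0//= ltr_pdivrMr// ltr_pMr// ltr1n.
by rewrite /= expr0n sub0r oppr_eq0 oner_eq0.
Qed.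

End Hermite.

(** * Combination of the two bounds and optimization over the friction *)

Theorem proposition13 (R : realType) (L : R) (L0 : 0 < L)
    (S : R -> R -> L2fun L0 -> L2fun L0)
    (WP : forall gamma, 0 < gamma -> well_posed gamma (S gamma)) :
  let m : R := pi ^+ 2 / L ^+ 2 in
  [/\ poincare_constant L0 = m%:E,
      forall gamma, 0 < gamma ->
        (optimal_decay_rate (S gamma)
          <= (Num.min (m / gamma) (2 * gamma))%:E)%E,
      (ereal_sup [set optimal_decay_rate (S gamma) | gamma in `]0%R, +oo[]
        <= (Num.sqrt (2 * m))%:E)%E,
      ereal_sup [set (Num.min (m / gamma) (2 * gamma))%:E
                | gamma in `]0%R, +oo[] = (Num.sqrt (2 * m))%:E /\
      Num.min (m / Num.sqrt (m / 2)) (2 * Num.sqrt (m / 2))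
        = Num.sqrt (2 * m) &
      forall gamma, 0 < gamma ->
        (optimal_decay_rate (S gamma)
          <= (Num.sqrt 2 * Num.sqrt m)%:E)%E].

Proof.
set m : R := _ / _; move=> m'; rewrite {}/m'.
have pi0 := pi_gt0 R.
have m0 : 0 < m by rewrite divr_gt0 ?exprn_gt0.
have rate gamma : 0 < gamma ->
    (optimal_decay_rate (S gamma) <= (Num.min (m / gamma) (2 * gamma))%:E)%E.
  move=> g0; rewrite EFin_min le_min optimal_rate_le_hermite ?andbT//; last exact: WP.
  rewrite /m -expr_div_n; apply: optimal_rate_le_wave => //.
  - by rewrite divr_gt0.
  - exact: WP.
  - by rewrite divfK// gt_eqF.
have poin : poincare_constant L0 = m%:E by exact: poincare_constantE.
clearbody m.
have min_le gamma : 0 < gamma ->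
    Num.min (m / gamma) (2 * gamma) <= Num.sqrt (2 * m).
  move=> g0; have a0 : 0 < m / gamma by rewrite divr_gt0.
  have b0 : 0 < 2 * gamma by rewrite mulr_gt0.
  set x := Num.min _ _.
  have x0 : 0 <= x by rewrite le_min !ltW.
  have xa : x <= m / gamma by rewrite ge_min lexx.
  have xb : x <= 2 * gamma by rewrite ge_min lexx orbT.
  rewrite -(ger0_norm x0) -sqrtr_sqr ler_sqrt; last by rewrite mulr_ge0// (ltW m0).
  (* The product of the two bounds does not depend on [gamma], so the square of their minimum is at
     most [2 m]. *)
  have -> : 2 * m = (m / gamma) * (2 * gamma) by field; rewrite gt_eqF.
  by rewrite expr2 ler_pM.
(* The friction [sqrt (m / 2)] is where the decreasing bound [m / gamma] meets the increasing bound
   [2 gamma]. *)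
have s0 : 0 < Num.sqrt (m / 2) by rewrite sqrtr_gt0 divr_gt0.
have s2 : Num.sqrt (m / 2) * Num.sqrt (m / 2) = m / 2.
  by rewrite -expr2 sqr_sqrtr// divr_ge0 ?(ltW m0).
have E : 2 * Num.sqrt (m / 2) = Num.sqrt (2 * m).
  rewrite -[LHS]ger0_norm ?mulr_ge0 ?(ltW s0)// -sqrtr_sqr; congr Num.sqrt.
  by rewrite expr2 mulrACA s2; field.
have attained : Num.min (m / Num.sqrt (m / 2)) (2 * Num.sqrt (m / 2)) =
    Num.sqrt (2 * m).
  have -> : m / Num.sqrt (m / 2) = 2 * Num.sqrt (m / 2).
    apply: (mulIf (lt0r_neq0 s0)).
    by rewrite (divfK (lt0r_neq0 s0)) -mulrA s2; field.
  by rewrite minxx.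
split => //.
- apply: ge_ereal_sup => _ [gamma /= + <-]; rewrite in_itv/= andbT => g0.
  by rewrite (le_trans (rate _ g0))// lee_fin min_le.
- split => //; apply/eqP; rewrite eq_le; apply/andP; split.
    apply: ge_ereal_sup => _ [gamma /= + <-]; rewrite in_itv/= andbT => g0.
    by rewrite lee_fin min_le.
  apply: ereal_sup_ubound; exists (Num.sqrt (m / 2)); last by rewrite attained.
  by rewrite /= in_itv/= s0.
- move=> gamma g0; rewrite -sqrtrM// (le_trans (rate _ g0))// lee_fin.
  exact: min_le.
Qed.
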